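(* Consider a pairwise separable convex program with graph $(V,E)$ and objective $F:\mathbb{R}^V\to\mathbb{R}$, and suppose that $F$ is $(\lambda,w)$-scaled diagonally dominant. Assume that the initial messages $\{J^{(0)}_{i\to j}(\cdot)\}_{(i,j)\in\vec E}$ of the min-sum algorithm satisfy the initialization assumption stated in the context. Define the constant $$K=\frac{1}{M}\,\frac{\max_{u\in V} w_u}{\min_{u\in V} w_u}.$$ Then, for every time $t$, the iterates of the min-sum algorithm satisfy $$\|x^{(t)}-x^*\|_\infty\le K\,\frac{\lambda^t}{1-\lambda}\sum_{(u,v)\in\vec E}\left|\frac{d}{dx_v}J^{(0)}_{u\to v}(x^*_v)-\frac{\partial}{\partial x_v}f_{uv}(x^*_u,x^*_v)\right|.$$ Hence, $\lim_{t\to\infty}x^{(t)}=x^*$.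
   Context: **Pairwise separable convex program.** Let $(V,E)$ be a finite undirected graph, $V=\{1,\dots,n\}$. The problem is to minimize $$F(x)=\sum_{i\in V}f_i(x_i)+\sum_{(i,j)\in E}f_{ij}(x_i,x_j)$$ over $x\in\mathbb{R}^V$, where each $f_i:\mathbb{R}\to\mathbb{R}$ is strictly convex, coercive and twice continuously differentiable, each $f_{ij}:\mathbb{R}^2\to\mathbb{R}$ is convex and twice continuously differentiable, and $$M:=\min_{i\in V}\inf_{x\in\mathbb{R}^V}\frac{\partial^2}{\partial x_i^2}F(x)>0.$$ There is one factor per undirected edge; $f_{ij}(x_i,x_j)$ and $f_{ji}(x_j,x_i)$ denote the same factor. $x^*\in\mathbb{R}^V$ denotes the unique minimizer of $F$. $N(i)=\{j\in V:(i,j)\in E\}$ is the set of neighbors of $i$, and $\vec E=\{(i,j)\in V\times V: i\in N(j)\}$ is the set of directed edges. **Scaled diagonal dominance.** $F:\mathbb{R}^V\to\mathbb{R}$ is $(\lambda,w)$-scaled diagonally dominant if $0<\lambda<1$ is a scalar and $w\in\mathbb{R}^V$ is a vector with all components positive such that for each $i\in V$ and all $x\in\mathbb{R}^V$, $$\sum_{j\in V\setminus i}w_j\left|\frac{\partial^2}{\partial x_i\partial x_j}F(x)\right|\le\lambda w_i\frac{\partial^2}{\partial x_i^2}F(x).$$ **Min-sum algorithm.** Given initial messages $J^{(0)}_{i\to j}:\mathbb{R}\to\mathbb{R}$, $(i,j)\in\vec E$, messages evolve by $$J^{(t+1)}_{i\to j}(x_j)=\min_{y_i\in\mathbb{R}}\Big(f_i(y_i)+f_{ij}(y_i,x_j)+\sum_{u\in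 N(i)\setminus j}J^{(t)}_{u\to i}(y_i)\Big)+\kappa^{(t+1)}_{i\to j},$$ where $\kappa^{(t+1)}_{i\to j}$ are arbitrary real constants (not depending on $x_j$). At each time $t>0$ the local objectives and estimates are $$b^{(t)}_i(x_i)=f_i(x_i)+\sum_{u\in N(i)}J^{(t)}_{u\to i}(x_i),\qquad x^{(t)}_i=\operatorname{argmin}_{y_i}b^{(t)}_i(y_i).$$ **Initialization assumption.** The initial messages are twice continuously differentiable and for each $(i,j)\in\vec E$ there exists $z_{i\to j}\in\mathbb{R}$ with $$\frac{d^2}{dx_j^2}J^{(0)}_{i\to j}(x_j)\ge\frac{\partial^2}{\partial x_j^2}f_{ij}(z_{i\to j},x_j)\quad\text{for all }x_j\in\mathbb{R}.$$ *)

(* Defs.v *)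
From HB Require Import structures.
From mathcomp Require Import all_boot all_order all_algebra.
From mathcomp Require Import all_classical all_reals all_analysis.

Set Implicit Arguments.
Unset Strict Implicit.
Unset Printing Implicit Defensive.

Import Order.TTheory GRing.Theory Num.Theory.
Import numFieldNormedType.Exports.

Local Open Scope ring_scope.
Local Open Scope classical_set_scope.

Section Calculus.
Context {R : realType}.

Definition C2 (f : R -> R) : Prop :=
  [/\ forall x, derivable f x 1,
      forall x, derivable f^`() x 1 &
      continuous f^`(2)].

(* The partial derivative in the first argument is [partial1of2]. *)
Definition partial2of2 (f : R -> R -> R) : R -> R -> R :=
  fun x y => (f x)^`() y.

(* Functions of two variables are curried, but continuity is always joint
   continuity on the plane. *)
Fixpoint Ck2 (k : nat) (f : R -> R -> R) : Prop :=
  continuous (fun p : R * R => f p.1 p.2) /\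
  if k is k'.+1 then
    [/\ forall x y, derivable (f^~ y) x 1,
        forall x y, derivable (f x) y 1,
        Ck2 k' (partial1of2 f) &
        Ck2 k' (partial2of2 f)]
  else True.

Definition strictly_convex (f : R -> R) : Prop :=
  forall x y t : R, x != y -> 0 < t < 1 ->
    f (t * x + (1 - t) * y) < t * f x + (1 - t) * f y.

Definition convex2 (f : R -> R -> R) : Prop :=
  convex_function [set: (R^o * R^o)%type] (fun p => f p.1 p.2).

Definition coercive (f : R -> R) : Prop :=
  f x @[x --> +oo] --> +oo /\ f x @[x --> -oo] --> +oo.

(* Both are total: if [g] has no minimizer, [argmin g] is 0. *)
Definition argmin (T : nmodType) (g : T -> R) : T :=
  xget 0 [set y | forall z, g y <= g z].

Definition minval (g : R -> R) : R := g (argmin g).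

Definition minV n (g : 'I_n.+1 -> R) : R :=
  \big[Num.min/g ord0]_(i < n.+1) g i.

Definition maxV n (g : 'I_n.+1 -> R) : R :=
  \big[Num.max/g ord0]_(i < n.+1) g i.

Definition d2 n (i j : 'I_n) (F : 'rV[R]_n -> R) : 'rV[R]_n -> R :=
  'D_(delta_mx 0 i) ('D_(delta_mx 0 j) F).

Definition scaled_diag_dominant n (lambda : R) (w : 'rV[R]_n)
    (F : 'rV[R]_n -> R) : Prop :=
  [/\ 0 < lambda < 1,
      forall i, 0 < w 0 i &
      forall i x, \sum_(j | j != i) w 0 j * `|d2 i j F x|
                    <= lambda * w 0 i * d2 i i F x].

End Calculus.

(* A graph on the nonempty vertex set 'I_n.+1 is a symmetric irreflexive
   relation [e]; [fv i] is the factor of the vertex i, and [fe i j] that of the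
   edge {i, j}, with the variable of i as first argument. *)
Section MinSum.
Context {R : realType} {n : nat}.
Local Notation V := 'I_n.+1.
Variables (e : rel V) (fv : V -> R -> R) (fe : V -> V -> R -> R -> R).

(* The restriction i < j makes each undirected edge count once. *)
Definition objective (x : 'rV[R]_n.+1) : R :=
  \sum_i fv i (x 0 i) +
  \sum_i \sum_(j | e i j && (i < j)%N) fe i j (x 0 i) (x 0 j).

(* If the infimum is taken over a set that is not bounded below, [inf] is 0;
   the condition that this constant be positive excludes that case. *)
Definition curvature : R :=
  minV (fun i : V => inf (range (d2 i i objective))).

Definition pairwise_separable_convex : Prop :=
  [/\ symmetric e /\ irreflexive e,
      forall i j, e i j -> forall x y, fe i j x y = fe j i y x,
      forall i, [/\ strictly_convex (fv i), coercive (fv i) & C2 (fv i)],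
      forall i j, e i j -> convex2 (fe i j) /\ Ck2 2 (fe i j) &
      0 < curvature].

Definition minimizer : 'rV[R]_n.+1 := argmin objective.

Variables (kappa : nat -> V -> V -> R) (J0 : V -> V -> R -> R).

Definition admissible_init : Prop :=
  forall i j, e i j ->
    C2 (J0 i j) /\
    exists z : R, forall x,
      partial2of2 (partial2of2 (fe i j)) z x <= (J0 i j)^`(2) x.

(* Only the values at pairs (i, j) with [e i j] are meaningful. *)
Fixpoint message (t : nat) : V -> V -> R -> R :=
  if t is t'.+1 then
    fun i j x =>
      minval (fun y => fv i y + fe i j y x +
                       \sum_(u | e i u && (u != j)) message t' u i y)
      + kappa t'.+1 i j
  else J0.

Definition local_objective (t : nat) (i : V) (y : R) : R :=
  fv i y + \sum_(u | e i u) message t u i y.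

Definition estimate (t : nat) : 'rV[R]_n.+1 :=
  \row_i argmin (local_objective t i).

End MinSum.

(* Main.v *)
(* By the envelope theorem the message J_(i -> j) has derivative
   d_2 f_ij (Y x, x), where Y x, the response of i, minimizes the local problem
   given x_j = x.  Hence the stationarity conditions of the local problems are
   the equation d_i F = 0 at the configuration that puts the responses at the
   neighbors of i, up to a nondecreasing remainder at time 0.  The mean value
   theorem for d_i F and scaled diagonal dominance give a maximum principle for
   differences weighted by w: the difference at i is at most lambda times the
   largest difference at the neighbors.  It follows that responses are
   1-Lipschitz, and then that
     |Y x - x*_i| / w_i <= max (|x - x*_j| / w_j, C_t)
   with C_(t+1) = lambda C_t.  Since this is a maximum and not a sum, no factor
   is lost when the bound is used at the solution of the next local problem. *)

Require Import Defs.
From HB Require Import structures.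
From mathcomp Require Import all_boot all_order all_algebra.
From mathcomp Require Import all_classical all_reals all_analysis.
From mathcomp Require Import ring lra.

Set Implicit Arguments.
Unset Strict Implicit.
Unset Printing Implicit Defensive.

Import Order.TTheory GRing.Theory Num.Theory.
Import numFieldNormedType.Exports.

Local Open Scope ring_scope.
Local Open Scope classical_set_scope.

(** * Calculus in one and two variables: chain rules, mixed partials, envelope theorem *)

Section Calculus.
Context {R : realType}.

(** The distance bound and the sign of the product together place [c] between [a] and [b], whichever
    of the two is larger. *)
Lemma mean_value_oriented (f : R -> R) (a b : R) :
  (forall x, derivable f x 1) ->
  exists c, [/\ `|c - a| <= `|b - a|, 0 <= (c - a) * (b - a) &
    f b - f a = derive1 f c * (b - a)].
Proof.
move=> df.
have cf : continuous f.
  by move=> x; apply/differentiable_continuous/derivable1_diffP.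
have idf (x : R) : is_derive x 1 f (derive1 f x).
  by rewrite derive1E; exact: DeriveDef (df x) _.
have [ab|/ltW ba] := leP a b.
- have [c] := MVT_segment ab (fun x _ => idf x) (continuous_subspaceT cf).
  rewrite in_itv /= => /andP[ac cb] E; exists c; split => //.
    by rewrite !ger0_norm ?subr_ge0// lerD2r.
  by apply: mulr_ge0; rewrite subr_ge0.
- have [c] := MVT_segment ba (fun x _ => idf x) (continuous_subspaceT cf).
  rewrite in_itv /= => /andP[bc ca] E; exists c; split.
  + by rewrite !ler0_norm ?subr_le0// !opprB lerD2l lerN2.
  + by apply: mulr_le0; rewrite subr_le0.
  + by rewrite -opprB E -mulrN opprB.
Qed.

Lemma mean_value (f : R -> R) (a b : R) : (forall x, derivable f x 1) ->
  exists c, `|c - a| <= `|b - a| /\ f b - f a = derive1 f c * (b - a).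
Proof. by move=> /(mean_value_oriented a b)[c []]; exists c. Qed.

Lemma stationary (f : R -> R) y : (forall x, derivable f x 1) ->
  (forall z, f y <= f z) -> derive1 f y = 0.
Proof.
move=> df fy; rewrite derive1E.
have y1 : y - 1 <= y + 1 by rewrite lerD2l; lra.
have yin : y \in `]y - 1, y + 1[%R by rewrite in_itv/=; apply/andP; split; lra.
by have [] := derive1_at_min y1 (fun t _ => df t) yin (fun t _ => fy t).
Qed.

Lemma cvg_near_eq (T : Type) (F : set_system T) {FF : Filter F}
    (u v : T -> R) (l : R) :
  u h @[h --> F] --> l -> F [set h | u h = v h] -> v h @[h --> F] --> l.
Proof. by move=> ul uv; apply: cvg_trans ul; exact: near_eq_cvg. Qed.

Lemma cvg_is_derive (V : normedModType R) (f : V -> R) x v (l : R) :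
  (h^-1 *: (f (h *: v + x) - f x)) @[h --> 0^'] --> l -> is_derive x v f l.
Proof.
by move=> h; apply: DeriveDef; [apply/cvg_ex; exists l|exact: cvg_lim h].
Qed.

Lemma is_derive_val (V : normedModType R) (f : V -> R) x v (l : R) :
  is_derive x v f l -> 'D_v f x = l.
Proof. by case. Qed.

Lemma is_derive_ex (V : normedModType R) (f : V -> R) x v (l : R) :
  is_derive x v f l -> derivable f x v.
Proof. by case. Qed.

Lemma is_derive_cvg (V : normedModType R) (f : V -> R) x v (l : R) :
  is_derive x v f l -> (h^-1 *: (f (h *: v + x) - f x)) @[h --> 0^'] --> l.
Proof. by move=> [d <-]; exact: d. Qed.

Lemma is_derive_cvg_line (V : normedModType R) (f : V -> R) x v (l : R) :
  is_derive x v f l -> f (h *: v + x) @[h --> 0^'] --> f x.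
Proof.
move=> /is_derive_cvg H.
have h0 : (h : R) @[h --> 0^'] --> (0 : R) by apply: cvg_within.
rewrite -[X in _ --> X]addr0 -[X in _ + X](mul0r l).
apply: (cvg_near_eq (cvgD (cvg_cst (f x)) (cvgM h0 H))); near=> h => /=.
have h0' : h != 0 by near: h; exact: nbhs_dnbhs_neq.
by rewrite /GRing.scale/= mulVKf// addrC subrK.
Unshelve. all: by end_near.
Qed.

Lemma cvg_dominated (T : Type) (F : set_system T) {FF : Filter F}
    (u v : T -> R) (a : R) :
  (forall h, `|u h - a| <= `|v h - a|) -> v h @[h --> F] --> a ->
  u h @[h --> F] --> a.
Proof.
move=> uv /cvgrPdist_le H; apply/cvgrPdist_le => eps /H; apply: filterS => h.
by rewrite distrC (distrC a (u h)); exact: le_trans.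
Qed.

Lemma cvg_uncurry (T : Type) (F : set_system T) {FF : Filter F}
    (g : R -> R -> R) (u v : T -> R) (a b : R) :
  continuous (fun p : R * R => g p.1 p.2) ->
  u h @[h --> F] --> a -> v h @[h --> F] --> b ->
  g (u h) (v h) @[h --> F] --> g a b.
Proof.
move=> cg ua vb.
exact: (cvg_comp _ (fun p : R * R => g p.1 p.2) (cvg_pair ua vb) (cg (a, b))).
Qed.

(** The increment is split into a step in the first argument and a step in the second. The mean
    value theorem turns each into a partial derivative at an intermediate point, and joint
    continuity of the partials gives the limit. *)
Lemma is_derive_chain2 (V : normedModType R) (f : R -> R -> R)
    (a b : V -> R) x v (da db : R) :
  (forall s t, derivable (f^~ t) s 1) -> (forall s t, derivable (f s) t 1) ->
  continuous (fun p : R * R => partial1of2 f p.1 p.2) ->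
  continuous (fun p : R * R => partial2of2 f p.1 p.2) ->
  is_derive x v a da -> is_derive x v b db ->
  is_derive x v (fun y => f (a y) (b y))
    (partial1of2 f (a x) (b x) * da + partial2of2 f (a x) (b x) * db : R).
Proof.
move=> d1 d2 c1 c2 Da Db.
(* Choice makes the intermediate points functions of [h], so that their limits can be taken. *)
have [xi Hxi] := boolp.choice (fun h : R =>
  mean_value (a x) (a (h *: v + x)) (fun s => d1 s (b (h *: v + x)))).
have [eta Heta] := boolp.choice (fun h : R =>
  mean_value (b x) (b (h *: v + x)) (d2 (a x))).
apply: cvg_is_derive.
have ca := is_derive_cvg_line Da; have cb := is_derive_cvg_line Db.
have cxi : xi h @[h --> 0^'] --> a x.
  exact: cvg_dominated (fun h => (Hxi h).1) ca.
have ceta : eta h @[h --> 0^'] --> b x.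
  exact: cvg_dominated (fun h => (Heta h).1) cb.
have L1 : partial1of2 f (xi h) (b (h *: v + x)) @[h --> 0^']
  --> partial1of2 f (a x) (b x).
  exact: cvg_uncurry c1 cxi cb.
have L2 : partial2of2 f (a x) (eta h) @[h --> 0^']
  --> partial2of2 f (a x) (b x).
  exact: cvg_uncurry c2 (cvg_cst (a x)) ceta.
apply: (cvg_near_eq (cvgD (cvgM L1 (is_derive_cvg Da))
  (cvgM L2 (is_derive_cvg Db)))).
near=> h => /=.
rewrite (_ : f (a (h *: v + x)) (b (h *: v + x)) - f (a x) (b x) =
   (f (a (h *: v + x)) (b (h *: v + x)) - f (a x) (b (h *: v + x))) +
   (f (a x) (b (h *: v + x)) - f (a x) (b x))); last by ring.
by rewrite (Hxi h).2 (Heta h).2 /GRing.scale/= /partial1of2 /partial2of2; ring.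
Unshelve. all: by end_near.
Qed.

Lemma is_derive_chain (V : normedModType R) (f : R -> R) (a : V -> R)
    x v (da : R) :
  (forall s, derivable f s 1) -> continuous f^`() -> is_derive x v a da ->
  is_derive x v (fun y => f (a y)) (derive1 f (a x) * da : R).
Proof.
move=> df cf Da; pose g (s _ : R) := f s.
have E : partial2of2 g = fun _ _ => 0.
  by apply/funext => s; apply/funext => t; rewrite /partial2of2 derive1_cst.
have d1 s t : derivable (g^~ t) s 1 by exact: df.
have d2 s t : derivable (g s) t 1 by exact: derivable_cst.
have c1 : continuous (fun p : R * R => partial1of2 g p.1 p.2).
  move=> p; exact: (cvg_comp _ (derive1 f) cvg_fst (cf p.1)).
have c2 : continuous (fun p : R * R => partial2of2 g p.1 p.2).
  by rewrite E; exact: cst_continuous.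
by have := is_derive_chain2 d1 d2 c1 c2 Da Da; rewrite E mul0r addr0.
Qed.

Lemma is_derive_coord n (x v : 'rV[R]_n.+1) i :
  is_derive x v (fun y : 'rV[R]_n.+1 => y 0 i) (v 0 i).
Proof.
apply: cvg_is_derive; apply: cvg_near_cst; near=> h.
have h0' : h != 0 by near: h; exact: nbhs_dnbhs_neq.
by rewrite !mxE addrK /GRing.scale/= mulKf.
Unshelve. all: by end_near.
Qed.

Lemma is_derive_line (V : normedModType R) (f : V -> R) q v (s l : R) :
  is_derive (q + s *: v) v f l -> is_derive s 1 (fun s => f (q + s *: v)) l.
Proof.
move=> /is_derive_cvg H; apply: cvg_is_derive; apply: (cvg_near_eq H).
near=> h => /=.
by rewrite [h *: 1]mulr1 scalerDl addrCA.
Unshelve. all: by end_near.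
Qed.

Lemma is_derive_big_sum (V : normedModType R) (I : finType) (P : pred I)
    (h : I -> V -> R) x v (dh : I -> R) :
  (forall i, P i -> is_derive x v (h i) (dh i)) ->
  is_derive x v (fun y => \sum_(i | P i) h i y) (\sum_(i | P i) dh i).
Proof.
move=> H; rewrite -fct_sumE.
elim/big_ind2: _ => // [|f a g b].
- exact: is_derive_cst.
- exact: is_deriveD.
Qed.

(* The second difference is symmetric in the two arguments of [f], which gives
   the equality of mixed partials. *)
Lemma second_difference (f : R -> R -> R) a b h k :
  (forall s t, derivable (f^~ t) s 1) ->
  (forall s t, derivable (partial1of2 f s) t 1) ->
  exists p : R * R, [/\ `|p.1 - a| <= `|h|, `|p.2 - b| <= `|k| &
    f (a + h) (b + k) - f (a + h) b - (f a (b + k) - f a b) =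
    partial2of2 (partial1of2 f) p.1 p.2 * h * k].
Proof.
move=> d1 d12.
have addK (x y : R) : x + y - x = y by rewrite addrAC subrr add0r.
have dg x : derivable (fun s => f s (b + k) - f s b) x 1 by exact: derivableB.
have [xi []] := mean_value a (a + h) dg; rewrite addK => xia ->.
have -> : derive1 (fun s => f s (b + k) - f s b) xi =
    partial1of2 f xi (b + k) - partial1of2 f xi b.
  by rewrite derive1E (deriveB (d1 _ _) (d1 _ _)) -!derive1E.
have [eta []] := mean_value b (b + k) (d12 xi); rewrite addK => etab ->.
by exists (xi, eta); split => //; rewrite /partial2of2/=; ring.
Qed.

(** Both orders of differentiation express the same second difference with equal steps [h], at
    points whose coordinates are within [|h|] of [x] and [y]. Dividing by the square of [h] and
    letting [h] tend to 0 identifies them. *)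
Lemma mixed_partials_commute (f : R -> R -> R) x y : Ck2 2 f ->
  partial1of2 (partial2of2 f) x y = partial2of2 (partial1of2 f) x y.
Proof.
move=> [_ [d1 d2 [_ [_ d12 _ [c12 _]]] [_ [d21 _ [c21 _] _]]]].
have [p Hp] := boolp.choice (fun h : R =>
  second_difference x y h h d1 d12).
(* The arguments of [f] are exchanged here, so the first component of [q h] is the one near [y]. *)
have [q Hq] := boolp.choice (fun h : R =>
  @second_difference (fun s t => f t s) y x h h (fun s t => d2 t s)
    (fun s t => d21 t s)).
have norm0 : (h : R) @[h --> 0^'] --> (0 : R) by apply: cvg_within.
have to_base (u : R -> R) z :
    (forall h, `|u h - z| <= `|h|) -> u h @[h --> 0^'] --> z.
  move=> uz; rewrite -[z]addr0.
  apply: cvg_dominated (cvgD (cvg_cst z) norm0) => h /=.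
  by rewrite addr0 (addrAC z) subrr add0r.
have p1 : (p h).1 @[h --> 0^'] --> x.
  by apply: to_base => h; have [] := Hp h.
have p2 : (p h).2 @[h --> 0^'] --> y.
  by apply: to_base => h; have [] := Hp h.
have q1 : (q h).1 @[h --> 0^'] --> y.
  by apply: to_base => h; have [] := Hq h.
have q2 : (q h).2 @[h --> 0^'] --> x.
  by apply: to_base => h; have [] := Hq h.
have L1 : partial2of2 (partial1of2 f) (p h).1 (p h).2 @[h --> 0^']
  --> partial2of2 (partial1of2 f) x y by exact: cvg_uncurry c12 p1 p2.
have L2 : partial1of2 (partial2of2 f) (q h).2 (q h).1 @[h --> 0^']
  --> partial1of2 (partial2of2 f) x y by exact: cvg_uncurry c21 q2 q1.
rewrite -(cvg_lim (@Rhausdorff R) L2).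
apply: (cvg_lim (@Rhausdorff R)); apply: (cvg_near_eq L1); near=> h => /=.
have h0 : h != 0 by near: h; exact: nbhs_dnbhs_neq.
have [_ _ E1] := Hp h; have [_ _ E2] := Hq h.
apply: (mulIf h0); apply: (mulIf h0).
by apply: (etrans (esym E1)); apply: etrans E2; ring.
Unshelve. all: by end_near.
Qed.

(** A squeeze: keeping the old minimizer [Y x] at the new parameter bounds the increment of the
    minimal value from above, and using the new minimizer at the old parameter bounds it from below.
    Both bounds are [h] times a partial derivative of [f] at points that converge, since [Y] is
    continuous. *)
Lemma envelope (S : R -> R) (f : R -> R -> R) (Y : R -> R) (x : R) :
  (forall s t, derivable (f s) t 1) ->
  continuous (fun p : R * R => partial2of2 f p.1 p.2) -> continuous Y ->
  (forall x z, S (Y x) + f (Y x) x <= S z + f z x) ->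
  is_derive x 1 (fun x => S (Y x) + f (Y x) x : R) (partial2of2 f (Y x) x : R).
Proof.
move=> df cf cY minY.
have [xi Hxi] := boolp.choice (fun h : R =>
  mean_value x (h *: 1 + x) (df (Y x))).
have [eta Heta] := boolp.choice (fun h : R =>
  mean_value x (h *: 1 + x) (df (Y (h *: 1 + x)))).
have cx : (h *: 1 + x : R) @[h --> 0^'] --> x.
  exact: is_derive_cvg_line (is_derive_id x 1).
have cxi : xi h @[h --> 0^'] --> x.
  exact: cvg_dominated (fun h => (Hxi h).1) cx.
have ceta : eta h @[h --> 0^'] --> x.
  exact: cvg_dominated (fun h => (Heta h).1) cx.
have cYx : Y (h *: 1 + x) @[h --> 0^'] --> Y x.
  exact: (cvg_comp _ Y cx (cY x)).
have P : partial2of2 f (Y x) (xi h) @[h --> 0^'] --> partial2of2 f (Y x) x.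
  exact: cvg_uncurry cf (cvg_cst _) cxi.
have Q : partial2of2 f (Y (h *: 1 + x)) (eta h) @[h --> 0^']
    --> partial2of2 f (Y x) x.
  exact: cvg_uncurry cf cYx ceta.
apply: cvg_is_derive; apply/cvgrPdist_le => eps eps0.
move/cvgrPdist_le : P => /(_ _ eps0) P; move/cvgrPdist_le : Q => /(_ _ eps0) Q.
near=> h.
have h0 : h != 0 by near: h; exact: nbhs_dnbhs_neq.
have : `|partial2of2 f (Y x) x - partial2of2 f (Y x) (xi h)| <= eps by near: h.
have : `|partial2of2 f (Y x) x - partial2of2 f (Y (h *: 1 + x)) (eta h)| <= eps.
  by near: h.
have [_] := Hxi h; have [_] := Heta h.
rewrite -!/(partial2of2 _ _ _) addrK [h *: 1]mulr1 => E2 E1.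
have := minY x (Y (h + x)); have := minY (h + x) (Y x).
set u := partial2of2 f (Y (h + x)) (eta h) in E2 *.
set v := partial2of2 f (Y x) (xi h) in E1 *.
set l := partial2of2 f (Y x) x.
set D := S (Y (h + x)) + f (Y (h + x)) (h + x) - (S (Y x) + f (Y x) x).
move=> m1 m2.
have D1 : D <= v * h by rewrite -E1 /D; lra.
have D2 : u * h <= D by rewrite -E2 /D; lra.
rewrite !ler_norml => /andP[u1 u2] /andP[v1 v2].
rewrite [h^-1 *: D]mulrC.
(* Division by a negative [h] exchanges the upper and the lower bound. *)
have [hp|hn|h00] := ltgtP h 0; last by rewrite h00 eqxx in h0.
- have : u >= D / h by rewrite ler_ndivrMr.
  have : v <= D / h by rewrite ler_ndivlMr.
  by move=> ? ?; apply/andP; split; lra.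
- have : u <= D / h by rewrite ler_pdivlMr.
  have : v >= D / h by rewrite ler_pdivrMr.
  by move=> ? ?; apply/andP; split; lra.
Unshelve. all: by end_near.
Qed.

Lemma argmin_le (T : nmodType) (g : T -> R) y :
  (forall z, g y <= g z) -> forall z, g (argmin g) <= g z.
Proof.
by move=> gy; apply: (@xgetPex _ 0 [set y | forall z, g y <= g z]); exists y.
Qed.

Lemma continuous_sum (T : topologicalType) (I : finType) (P : pred I)
    (f : I -> T -> R) : (forall i, P i -> continuous (f i)) ->
  continuous (fun x => \sum_(i | P i) f i x).
Proof. by move=> cf; apply: continuous_big => //; exact: add_continuous. Qed.

End Calculus.

(** * First and second derivatives of the objective *)

Section Gradient.
Context {R : realType} {n : nat}.
Local Notation V := 'I_n.+1.
Variables (e : rel V) (fv : V -> R -> R) (fe : V -> V -> R -> R -> R).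
Hypothesis hprog : pairwise_separable_convex e fv fe.
Local Notation F := (objective e fv fe).

Let esym : symmetric e. Proof. by case: hprog => -[]. Qed.
Let eirr : irreflexive e. Proof. by case: hprog => -[]. Qed.

Let fesym i j x y : e i j -> fe i j x y = fe j i y x.
Proof. by case: hprog => _ H _ _ _ /H. Qed.

Let fvC2 i : C2 (fv i). Proof. by case: hprog => _ _ /(_ i)[]. Qed.

Let feC2 i j : e i j -> Ck2 2 (fe i j).
Proof. by case: hprog => _ _ _ H _ /H[]. Qed.

(** Every factor is written with the variable of [i] as second argument, as in the messages that [i]
    receives; the symmetry of the factors allows this for all neighbors at once. *)
Definition gradient (i : V) (x : 'rV[R]_n.+1) : R :=
  derive1 (fv i) (x 0 i) +
  \sum_(u | e i u) partial2of2 (fe u i) (x 0 u) (x 0 i).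

Lemma partial1_edge i j : e i j ->
  partial1of2 (fe i j) = fun x y => partial2of2 (fe j i) y x.
Proof.
move=> eij; apply/funext => x; apply/funext => y.
rewrite /partial1of2 /partial2of2; congr (derive1 _ x).
by apply/funext => z; rewrite fesym.
Qed.

Lemma mixed_partial_edge i j x y : e i j ->
  partial1of2 (partial2of2 (fe i j)) x y =
    partial1of2 (partial2of2 (fe j i)) y x.
Proof.
by move=> eij; rewrite (mixed_partials_commute _ _ (feC2 eij)) partial1_edge.
Qed.

Lemma is_derive_objective (x v : 'rV[R]_n.+1) :
  is_derive x v F (\sum_i gradient i x * v 0 i : R).
Proof.
have D1 : is_derive x v (fun y : 'rV[R]_n.+1 => \sum_i fv i (y 0 i))
    (\sum_i derive1 (fv i) (x 0 i) * v 0 i : R).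
  apply: is_derive_big_sum => i _; have [d1 d2 _] := fvC2 i.
  have c1 : continuous (derive1 (fv i)).
    by move=> s; apply/differentiable_continuous/derivable1_diffP; exact: d2.
  exact: (is_derive_chain d1 c1 (is_derive_coord x v i)).
have D2 : is_derive x v (fun y : 'rV[R]_n.+1 =>
      \sum_i \sum_(j | e i j && (i < j)%N) fe i j (y 0 i) (y 0 j))
    (\sum_i \sum_(j | e i j && (i < j)%N)
       (partial1of2 (fe i j) (x 0 i) (x 0 j) * v 0 i +
        partial2of2 (fe i j) (x 0 i) (x 0 j) * v 0 j) : R).
  apply: is_derive_big_sum => i _; apply: is_derive_big_sum => j /andP[eij _].
  have [_ [d1 d2 [c1 _] [c2 _]]] := feC2 eij.
  exact: (is_derive_chain2 d1 d2 c1 c2 (is_derive_coord x v i)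
    (is_derive_coord x v j)).
have edges : \sum_i \sum_(j | e i j && (i < j)%N)
       (partial1of2 (fe i j) (x 0 i) (x 0 j) * v 0 i +
        partial2of2 (fe i j) (x 0 i) (x 0 j) * v 0 j) =
    \sum_i (\sum_(u | e i u) partial2of2 (fe u i) (x 0 u) (x 0 i)) * v 0 i.
  under eq_bigr do rewrite big_split/=.
  (* Each edge occurs once, with i < j. Its derivative in the second variable is moved to the
     endpoint [j], so that a vertex collects its larger neighbors from one sum and its smaller ones
     from the other. *)
  rewrite big_split/= [X in _ + X](exchange_big_dep predT)//= -big_split/=.
  apply: eq_bigr => i _; rewrite mulr_suml.
  rewrite [RHS](bigID (fun j : V => (i < j)%N))/=.
  congr (_ + _).
  - by apply: eq_bigr => j /andP[eij _]; rewrite partial1_edge.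
  - apply: eq_bigl => j; rewrite esym -leqNgt; case eji : (e i j) => //=.
    rewrite ltn_neqAle; case: eqP => // /val_inj ji.
    by rewrite ji eirr in eji.
apply: (@is_derive_eq _ _ _ F x v _ _ (is_deriveD D1 D2)).
rewrite edges -big_split/=.
by apply: eq_bigr => i _; rewrite /gradient mulrDl.
Qed.

Lemma sum_delta (c : V -> R) (P : pred V) j :
  \sum_(i | P i) c i * (delta_mx 0 j : 'rV[R]_n.+1) 0 i =
    if P j then c j else 0.
Proof.
rewrite big_mkcond (bigD1 j)//= big1 ?addr0; last first.
  by move=> i ij; rewrite mxE (negbTE ij) andbF mulr0; case: ifP.
by rewrite mxE !eqxx mulr1.
Qed.

Lemma derive_objective j : 'D_(delta_mx 0 j) F = gradient j.
Proof.
apply/funext => x; have := is_derive_objective x (delta_mx 0 j).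
by move/is_derive_val => ->; rewrite (@sum_delta (gradient^~ x) predT).
Qed.

Lemma is_derive_gradient_partials i (x v : 'rV[R]_n.+1) :
  is_derive x v (gradient i) (derive1 (derive1 (fv i)) (x 0 i) * v 0 i +
    \sum_(u | e i u)
      (partial1of2 (partial2of2 (fe u i)) (x 0 u) (x 0 i) * v 0 u +
       partial2of2 (partial2of2 (fe u i)) (x 0 u) (x 0 i) * v 0 i) : R).
Proof.
apply: is_deriveD.
  have [d1 d2 c2] := fvC2 i.
  exact: (is_derive_chain d2 c2 (is_derive_coord x v i)).
apply: is_derive_big_sum => u; rewrite esym => eui.
have [_ [_ _ _ [_ [d1 d2 [c1 _] [c2 _]]]]] := feC2 eui.
exact: (is_derive_chain2 d1 d2 c1 c2 (is_derive_coord x v u)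
  (is_derive_coord x v i)).
Qed.

Lemma d2_diag i x : d2 i i F x = derive1 (derive1 (fv i)) (x 0 i) +
  \sum_(u | e i u) partial2of2 (partial2of2 (fe u i)) (x 0 u) (x 0 i).
Proof.
have dii : (delta_mx 0 i : 'rV[R]_n.+1) 0 i = 1 by rewrite mxE !eqxx.
have diu u : e i u -> (delta_mx 0 i : 'rV[R]_n.+1) 0 u = 0.
  move=> eiu; have ui : u != i by apply: contraTneq eiu => ->; rewrite eirr.
  by rewrite mxE (negbTE ui) andbF.
have E := is_derive_val (is_derive_gradient_partials i x (delta_mx 0 i)).
rewrite /d2 derive_objective {}E dii [X in X + _]mulr1; congr (_ + _).
by apply: eq_bigr => u /diu E; rewrite E [X in X + _]mulr0 add0r [LHS]mulr1.
Qed.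

(** [d2 i j] differentiates [gradient j] in the direction of [i], while the right side is the
    coefficient that appears when [gradient i] is differentiated in the direction of [j]. The
    equality of mixed partials reconciles the two. *)
Lemma d2_edge i j x : e i j ->
  d2 i j F x = partial1of2 (partial2of2 (fe j i)) (x 0 j) (x 0 i).
Proof.
move=> eij; rewrite -(mixed_partial_edge _ _ eij).
have dij : (delta_mx 0 i : 'rV[R]_n.+1) 0 j = 0.
  have ji : j != i by apply: contraTneq eij => ->; rewrite eirr.
  by rewrite mxE (negbTE ji) andbF.
have E := is_derive_val (is_derive_gradient_partials j x (delta_mx 0 i)).
rewrite /d2 derive_objective {}E dij [X in X + _]mulr0 add0r.
transitivity (\sum_(u | e j u)
    partial1of2 (partial2of2 (fe u j)) (x 0 u) (x 0 j) *
    (delta_mx 0 i : 'rV[R]_n.+1) 0 u).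
  by apply: eq_bigr => u _; rewrite [X in _ + X]mulr0 addr0.
by rewrite (sum_delta (fun u => partial1of2 _ (x 0 u) _)) esym eij.
Qed.

Lemma is_derive_gradient i (x v : 'rV[R]_n.+1) :
  is_derive x v (gradient i)
    (d2 i i F x * v 0 i + \sum_(u | e i u) d2 i u F x * v 0 u : R).
Proof.
have edges : \sum_(u | e i u)
      (partial1of2 (partial2of2 (fe u i)) (x 0 u) (x 0 i) * v 0 u +
       partial2of2 (partial2of2 (fe u i)) (x 0 u) (x 0 i) * v 0 i) =
    \sum_(u | e i u) d2 i u F x * v 0 u +
    (\sum_(u | e i u) partial2of2 (partial2of2 (fe u i)) (x 0 u) (x 0 i)) *
    v 0 i.
  rewrite mulr_suml -big_split/=.
  by apply: eq_bigr => u eiu; rewrite (d2_edge _ eiu).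
apply: (is_derive_eq (is_derive_gradient_partials i x v)).
by rewrite edges d2_diag mulrDl addrAC addrA.
Qed.

(** The mean value theorem is applied along the segment from [q] to [p], so that the whole row [i]
    of second derivatives is taken at one point, as diagonal dominance requires. *)
Lemma gradient_mean_value i (p q : 'rV[R]_n.+1) : exists x,
  gradient i p - gradient i q = d2 i i F x * (p 0 i - q 0 i) +
    \sum_(u | e i u) d2 i u F x * (p 0 u - q 0 u).
Proof.
have D s := is_derive_line (is_derive_gradient i (q + s *: (p - q)) (p - q)).
have [c [_]] := mean_value 0 1 (fun s => is_derive_ex (D s)).
have -> : q + 1 *: (p - q) = p by rewrite scale1r addrC subrK.
have -> : q + 0 *: (p - q) = q by rewrite scale0r addr0.
rewrite subr0 mulr1 derive1E (is_derive_val (D c)) => ->.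
exists (q + c *: (p - q)); rewrite !mxE; congr (_ + _).
by apply: eq_bigr => u _; rewrite !mxE.
Qed.

End Gradient.

(** * Maximum principle for weighted differences *)

Section MinSumConvergence.
Context {R : realType} {n : nat}.
Local Notation V := 'I_n.+1.
Variables (e : rel V) (fv : V -> R -> R) (fe : V -> V -> R -> R -> R).
Variables (lambda : R) (w : 'rV[R]_n.+1).
Hypothesis hprog : pairwise_separable_convex e fv fe.
Local Notation F := (objective e fv fe).
Hypothesis hsdd : scaled_diag_dominant lambda w F.
Local Notation G := (gradient e fv fe).
Local Notation M := (curvature e fv fe).

Let eirr : irreflexive e. Proof. by case: hprog => -[]. Qed.
Let esym : symmetric e. Proof. by case: hprog => -[]. Qed.
Let M0 : 0 < M. Proof. by case: hprog. Qed.
Let lambda0 : 0 < lambda. Proof. by case: hsdd => /andP[]. Qed.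
Let lambda1 : lambda < 1. Proof. by case: hsdd => /andP[]. Qed.
Let w0 i : 0 < w 0 i. Proof. by case: hsdd => _ /(_ i). Qed.

Let feC2 i j : e i j -> Ck2 2 (fe i j).
Proof. by case: hprog => _ _ _ H _ /H[]. Qed.

Let l1 : 0 < 1 - lambda. Proof. by rewrite subr_gt0. Qed.

Lemma curvature_le i x : M <= d2 i i F x.
Proof.
have Mi : M <= inf (range (d2 i i F)).
  exact: (bigmin_le_cond _ (fun i : V => inf (range (d2 i i F)))).
have [hi|ni] := pselect (has_inf (range (d2 i i F))).
  by apply: le_trans Mi _; apply: ge_inf; [case: hi|exists x].
(* Without an infimum, [inf] would take its default value 0, against the positivity of the
   curvature. *)
by move: Mi; rewrite inf_out// leNgt M0.
Qed.

(** Here [h] is the diagonal second derivative at the mean value point. Diagonal dominance bounds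
    the other terms by a multiple of the same [h], so that [h] cancels later. *)
Lemma gradient_secant i (p q : 'rV[R]_n.+1) (m : R) : 0 <= m ->
  (forall u, e i u -> `|p 0 u - q 0 u| <= m * w 0 u) ->
  exists h, M <= h /\
    `|G i p - G i q - h * (p 0 i - q 0 i)| <= lambda * m * w 0 i * h.
Proof.
move=> m0 pq; have [x ->] := gradient_mean_value hprog i p q.
exists (d2 i i F x); split; first exact: curvature_le.
rewrite addrAC subrr add0r.
have [_ _ /(_ i x) dd] := hsdd.
apply: le_trans (ler_norm_sum _ _ _) _.
rewrite (_ : _ * _ = m * (lambda * w 0 i * d2 i i F x)); last by ring.
apply: le_trans (ler_wpM2l m0 dd); rewrite mulr_sumr.
rewrite big_mkcond/= [leRHS]big_mkcond/=; apply: ler_sum => u _.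
case: ifPn => [eiu|_].
  have -> : u != i by apply: contraTneq eiu => ->; rewrite eirr.
  rewrite normrM mulrC mulrA; apply: ler_wpM2r => //; exact: pq.
by case: ifP => // _; rewrite mulr_ge0// mulr_ge0// ltW.
Qed.

(** The maximum includes the difference at [i] itself because the responses at the neighbors move
    with [i]. Division by [h] leaves [lambda] on the first term, and [M <= h] controls the defect
    [eta]. *)
Lemma coordinate_bound i (p q : 'rV[R]_n.+1) (a r eta : R) :
  0 <= a -> 0 <= r * (p 0 i - q 0 i) ->
  `|G i p - G i q + r| <= eta ->
  (forall u, e i u ->
    `|p 0 u - q 0 u| <= Num.max a (`|p 0 i - q 0 i| / w 0 i) * w 0 u) ->
  `|p 0 i - q 0 i| / w 0 i <=
    lambda * Num.max a (`|p 0 i - q 0 i| / w 0 i) + eta / (M * w 0 i).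
Proof.
move=> a0; set d := p 0 i - q 0 i; set m := Num.max _ _ => rd Geta pq.
have m0 : 0 <= m by rewrite le_max a0.
have [h [Mh]] := gradient_secant m0 pq; rewrite -/d => Gh.
have h0 : 0 < h by exact: lt_le_trans Mh.
have eta0 : 0 <= eta by exact: le_trans Geta.
have : h * `|d| <= lambda * m * w 0 i * h + eta.
  have : `|h * d + r| <= lambda * m * w 0 i * h + eta.
    rewrite (_ : h * d + r =
      (G i p - G i q + r) - (G i p - G i q - h * d)); last by ring.
    by rewrite (le_trans (ler_normB _ _))// addrC lerD.
  (* [r] does not oppose [d], so dropping it from [h * d + r] cannot increase the absolute value. *)
  apply: le_trans; have [d0|d0|d0] := ltgtP d 0.
  - have r0 : r <= 0 by rewrite -(nmulr_lge0 _ d0).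
    by rewrite (ltr0_norm d0) -normrN; apply: (le_trans _ (ler_norm _)); nra.
  - have r0 : 0 <= r by rewrite -(pmulr_lge0 _ d0).
    by rewrite (gtr0_norm d0); apply: (le_trans _ (ler_norm _)); nra.
  - by rewrite d0 normr0 !mulr0.
move=> hd; rewrite ler_pdivrMr//.
rewrite mulrDl -(ler_pM2l h0) (le_trans hd)// mulrDr.
apply: lerD; first by rewrite mulrC.
have -> : eta / (M * w 0 i) * w 0 i = eta / M by field; rewrite !gt_eqF.
rewrite mulrCA ler_peMr//.
by rewrite ler_pdivlMr// mul1r.
Qed.

(** If the difference [b] at [i] attained the maximum, [b <= lambda * b] would force it to be at
    most 0; hence the maximum can be replaced by [a]. *)
Lemma coordinate_contract i (p q : 'rV[R]_n.+1) (a r : R) :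
  0 <= a -> 0 <= r * (p 0 i - q 0 i) ->
  G i p - G i q + r = 0 ->
  (forall u, e i u ->
    `|p 0 u - q 0 u| <= Num.max a (`|p 0 i - q 0 i| / w 0 i) * w 0 u) ->
  `|p 0 i - q 0 i| / w 0 i <= lambda * a.
Proof.
move=> a0 rd G0 pq; have := coordinate_bound a0 rd _ pq.
move=> /(_ 0); rewrite G0 normr0 lexx mul0r addr0 => /(_ isT).
have : 0 <= `|p 0 i - q 0 i| / w 0 i by rewrite divr_ge0// ltW.
set b := _ / _ => b0.
rewrite maxEle; case: ifP => // ab blb.
have : (1 - lambda) * b <= 0 by rewrite mulrBl mul1r subr_le0.
rewrite (pmulr_rle0 _ l1) => bn; apply: le_trans bn _.
by rewrite mulr_ge0// ltW.
Qed.

(** If the difference at [i] attains the maximum, its multiple by [lambda] is absorbed on the left,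
    which produces the factor 1 / (1 - lambda); otherwise it is below [a]. *)
Lemma coordinate_perturb i (p q : 'rV[R]_n.+1) (a r eta : R) :
  0 <= a -> 0 <= r * (p 0 i - q 0 i) ->
  `|G i p - G i q + r| <= eta ->
  (forall u, e i u ->
    `|p 0 u - q 0 u| <= Num.max a (`|p 0 i - q 0 i| / w 0 i) * w 0 u) ->
  `|p 0 i - q 0 i| / w 0 i <= Num.max a (eta / (M * w 0 i) / (1 - lambda)).
Proof.
move=> a0 rd G0 pq; have := coordinate_bound a0 rd G0 pq.
have : 0 <= `|p 0 i - q 0 i| / w 0 i by rewrite divr_ge0// ltW.
set b := _ / w 0 i; set c := eta / _ => b0.
rewrite le_max [Num.max a b]maxEle; case: ifP => ab bl.
  apply/orP; right; rewrite ler_pdivlMr//.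
  by rewrite mulrBr mulr1 (mulrC b); lra.
apply/orP; case: (leP c (a * (1 - lambda))) => ca; [left|right].
  by rewrite (le_trans bl)// (le_trans (lerD (lexx _) ca))//; lra.
rewrite ler_pdivlMr//; have := lambda0; have : 0 < 1 - lambda by [].
have : b < a by rewrite ltNge ab.
nra.
Qed.

(* [J] is a message from [u] to [i], and [Y y] is the position of [u] that [J]
   attributes to the position [y] of [i].  The remainder [r] is zero except at
   time 0, where [Y] is the constant of the initialization assumption. *)
Definition regular (u i : V) (J Y r : R -> R) : Prop :=
  [/\ forall y, derivable J y 1,
      continuous (derive1 J),
      forall y, derive1 J y = partial2of2 (fe u i) (Y y) y + r y,
      {homo r : x y / x <= y} &
      forall y z, `|Y y - Y z| / w 0 u <= `|y - z| / w 0 i].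

(** Only the entries at [i] and its neighbors matter, since [gradient i] reads no others. *)
Definition configuration (i : V) (y : R) (Y : V -> R -> R) : 'rV[R]_n.+1 :=
  \row_v (if v == i then y else Y v y).

Lemma configuration_self i y Y : configuration i y Y 0 i = y.
Proof. by rewrite mxE eqxx. Qed.

Lemma configuration_nbr i y Y u : e i u -> configuration i y Y 0 u = Y u y.
Proof.
move=> eiu; have ui : u != i by apply: contraTneq eiu => ->; rewrite eirr.
by rewrite mxE (negbTE ui).
Qed.

(** * The local problem at one vertex *)

Section LocalObjective.
Variables (i : V) (J Y r : V -> R -> R).
Hypothesis regJ : forall u, e i u -> regular u i (J u) (Y u) (r u).
Local Notation Psi := (fun y => fv i y + \sum_(u | e i u) J u y).
Local Notation config y := (configuration i y Y).

Lemma sum_monotone y z :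
  0 <= (\sum_(u | e i u) r u y - \sum_(u | e i u) r u z) * (y - z).
Proof.
rewrite -sumrB mulr_suml; apply: sumr_ge0 => u eiu.
have [_ _ _ mono _] := regJ eiu.
have [yz|/ltW zy] := leP y z.
  by apply: mulr_le0; rewrite subr_le0 ?mono.
by apply: mulr_ge0; rewrite subr_ge0 ?mono.
Qed.

Lemma is_derive_messages (y : R) :
  is_derive y 1 (fun y => \sum_(u | e i u) J u y)
    (\sum_(u | e i u) derive1 (J u) y : R).
Proof.
apply: is_derive_big_sum => u eiu; rewrite derive1E; apply: DeriveDef => //.
by have [dJ _ _ _ _] := regJ eiu.
Qed.

Lemma derivable_local y : derivable Psi y 1.
Proof.
have [_ _ /(_ i)[_ _ [d1 _ _]] _ _] := hprog.
apply: derivableD; first exact: d1.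
exact: is_derive_ex (is_derive_messages y).
Qed.

Lemma derive_local_messages y :
  derive1 Psi y = derive1 (fv i) y + \sum_(u | e i u) derive1 (J u) y.
Proof.
have [_ _ /(_ i)[_ _ [d1 _ _]] _ _] := hprog.
have D := is_derive_messages y.
rewrite derive1E (deriveD (d1 y) (is_derive_ex D)) (is_derive_val D).
by rewrite derive1E.
Qed.

(** This links the algorithm to [F]: the messages contribute the edge terms of d_i F, evaluated at
    the responses. *)
Lemma derive_local y :
  derive1 Psi y = G i (config y) + \sum_(u | e i u) r u y.
Proof.
rewrite derive_local_messages /gradient configuration_self -addrA -big_split/=.
congr (_ + _); apply: eq_bigr => u eiu.
by have [_ _ -> _ _] := regJ eiu; rewrite configuration_nbr.
Qed.

Lemma continuous_derive_local : continuous (derive1 Psi).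
Proof.
have -> : derive1 Psi =
    (fun y => derive1 (fv i) y + \sum_(u | e i u) derive1 (J u) y).
  by apply/funext => y; exact: derive_local_messages.
have [_ _ /(_ i)[_ _ [_ d2 _]] _ _] := hprog.
move=> y; apply: cvgD.
  exact/differentiable_continuous/derivable1_diffP/d2.
apply: (@continuous_sum _ _ _ (e i) (fun u => derive1 (J u))) => u eiu.
by have [_ + _ _ _] := regJ eiu; apply.
Qed.

Lemma configuration_lipschitz y z u : e i u ->
  `|config y 0 u - config z 0 u| <= `|y - z| / w 0 i * w 0 u.
Proof.
move=> eiu; rewrite !configuration_nbr//.
by have [_ _ _ _ /(_ y z)] := regJ eiu; rewrite ler_pdivrMr.
Qed.

(** As the responses are 1-Lipschitz in the weighted sense, the neighbors offset at most the
    fraction [lambda] of the diagonal growth, and the remainders only add to it. *)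
Lemma derive_local_strong y z : z <= y ->
  (1 - lambda) * M * (y - z) <= derive1 Psi y - derive1 Psi z.
Proof.
move=> zy; rewrite !derive_local.
have yz0 : 0 <= y - z by rewrite subr_ge0.
have m0 : 0 <= `|y - z| / w 0 i by rewrite divr_ge0// ltW.
have [h [Mh]] := gradient_secant m0 (@configuration_lipschitz y z).
rewrite !configuration_self -(mulrA lambda) mulfVK ?gt_eqF//.
rewrite (ger0_norm yz0) ler_norml => /andP[+ _].
have : \sum_(u | e i u) r u z <= \sum_(u | e i u) r u y.
  by apply: ler_sum => u eiu; have [_ _ _ + _] := regJ eiu; apply.
have : (1 - lambda) * M * (y - z) <= (1 - lambda) * h * (y - z).
  by rewrite ler_wpM2r// ler_wpM2l// subr_ge0 ltW.
nra.
Qed.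

Lemma local_argmin : (forall z, Psi (argmin Psi) <= Psi z) /\
  G i (config (argmin Psi)) + \sum_(u | e i u) r u (argmin Psi) = 0.
Proof.
have c0 : 0 < (1 - lambda) * M by rewrite mulr_gt0// subr_gt0.
(* At distance [N] from 0 the growth guaranteed by strong monotonicity equals the size of the
   derivative at 0, so the derivative changes sign between [- N] and [N]. *)
pose N := `|derive1 Psi 0| / ((1 - lambda) * M).
have N0 : 0 <= N by rewrite divr_ge0// ltW.
have EN : (1 - lambda) * M * N = `|derive1 Psi 0|.
  by rewrite mulrC divfK ?gt_eqF.
have PN : 0 <= derive1 Psi N.
  have := derive_local_strong N0; rewrite subr0 EN.
  have := ler_norm (- derive1 Psi 0); rewrite normrN; lra.
have PnN : derive1 Psi (- N) <= 0.
  have := @derive_local_strong 0 (- N); rewrite oppr_le0 => /(_ N0).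
  rewrite sub0r opprK EN.
  have := ler_norm (derive1 Psi 0); lra.
have NN : - N <= N by lra.
have [||c _ Pc] := @IVT R (derive1 Psi) (- N) N 0 NN.
- exact: continuous_subspaceT continuous_derive_local.
- by rewrite ge_min le_max PN PnN orbT.
have minc z : Psi c <= Psi z.
  have [x [_ xc E]] := mean_value_oriented c z derivable_local.
  rewrite -subr_ge0 {}E.
  have [cz|zc|<-] := ltgtP c z; last by rewrite subrr mulr0.
  - move: xc; rewrite pmulr_lge0 ?subr_gt0// subr_ge0 => cx.
    apply: mulr_ge0; last by rewrite subr_ge0 ltW.
    have := derive_local_strong cx; rewrite Pc subr0; apply: le_trans.
    by rewrite mulr_ge0 ?subr_ge0// ltW.
  - move: xc; rewrite nmulr_lge0 ?subr_lt0// subr_le0 => xc.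
    apply: mulr_le0; last by rewrite subr_le0 ltW.
    have := derive_local_strong xc; rewrite Pc sub0r lerNr => /le_trans; apply.
    by rewrite oppr_le0 mulr_ge0 ?subr_ge0// ltW.
(* [argmin Psi] is not identified with [c]; as a minimizer it is stationary itself. *)
split; first exact: (@argmin_le R _ Psi c minc).
rewrite -derive_local; apply: stationary; first exact: derivable_local.
exact: (@argmin_le R _ Psi c minc).
Qed.

End LocalObjective.

(* Fixing the position of a neighbor acts on [i] as a message with a constant
   response. *)
Lemma regular_edge i j x : e i j ->
  regular j i (fe i j ^~ x) (fun=> x) (fun=> 0).
Proof.
move=> eij; have [_ [d1 _ [c1 _] _]] := feC2 eij; split => //.
- move=> y; apply: (cvg_uncurry c1 _ (cvg_cst x)); exact: cvg_id.
- move=> y; rewrite addr0.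
  exact: (congr1 (fun f => f y x) (partial1_edge hprog eij)).
- by move=> y z; rewrite subrr normr0 mul0r divr_ge0// ltW.
Qed.

(** * One message update and its response *)

Section Update.
Variables (i j : V) (J Y r : V -> R -> R).
Hypothesis eij : e i j.
Hypothesis regJ : forall u, e i u -> u != j -> regular u i (J u) (Y u) (r u).

Definition update_objective (x : R) : R -> R :=
  fun y => fv i y + fe i j y x + \sum_(u | e i u && (u != j)) J u y.

Definition response (x : R) : R := argmin (update_objective x).

(** With x_j fixed, the update is a local problem over all neighbors of [i] in which the message
    from [j] is the edge factor itself. The type is generic because messages, responses and
    remainders are all modified this way. *)
Definition clamp (T : Type) (g : V -> T) (c : T) : V -> T :=
  fun u => if u == j then c else g u.

Lemma regular_clamp x u : e i u ->
  regular u i (clamp J (fe i j ^~ x) u) (clamp Y (fun=> x) u)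
    (clamp r (fun=> 0) u).
Proof.
rewrite /clamp; case: eqVneq => [->|uj] eiu; first exact: regular_edge.
exact: regJ.
Qed.

Lemma update_objectiveE x : update_objective x =
  fun y => fv i y + \sum_(u | e i u) clamp J (fe i j ^~ x) u y.
Proof.
apply/funext => y.
rewrite /update_objective [in RHS](bigD1 j)//= /clamp eqxx addrA.
by congr (_ + _); apply: eq_bigr => u /andP[_ /negbTE ->].
Qed.

Definition response_config (x y : R) : 'rV[R]_n.+1 :=
  configuration i y (clamp Y (fun=> x)).

Definition residual (y : R) : R := \sum_(u | e i u) clamp r (fun=> 0) u y.

Lemma response_config_self x y : response_config x y 0 i = y.
Proof. exact: configuration_self. Qed.

Lemma response_config_at x y : response_config x y 0 j = x.
Proof. by rewrite configuration_nbr// /clamp eqxx. Qed.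

Lemma response_config_nbr x y u : e i u -> u != j ->
  response_config x y 0 u = Y u y.
Proof.
by move=> eiu uj; rewrite configuration_nbr// /clamp (negbTE uj).
Qed.

Lemma residual_monotone y z : 0 <= (residual y - residual z) * (y - z).
Proof. exact: sum_monotone (regular_clamp 0) y z. Qed.

Lemma response_min x z :
  update_objective x (response x) <= update_objective x z.
Proof.
rewrite /response update_objectiveE.
have [+ _] := local_argmin (regular_clamp x); exact.
Qed.

Lemma response_stationary x :
  G i (response_config x (response x)) + residual (response x) = 0.
Proof.
rewrite /response update_objectiveE.
by have [_] := local_argmin (regular_clamp x).
Qed.

Lemma response_config_lipschitz x x' y y' u : e i u ->
  `|response_config x y 0 u - response_config x' y' 0 u| <=
    Num.max (`|x - x'| / w 0 j) (`|y - y'| / w 0 i) * w 0 u.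
Proof.
move=> eiu; rewrite -ler_pdivrMr// le_max; apply/orP.
have [->|uj] := eqVneq u j; first by left; rewrite !response_config_at.
right; rewrite !response_config_nbr//.
by have [_ _ _ _ +] := regJ eiu uj; exact.
Qed.

(** Two stationary configurations are compared: neighbor [j] moves with the parameter, and the other
    neighbors move no more than [i] does. *)
Lemma response_lipschitz x x' :
  `|response x - response x'| / w 0 i <= `|x - x'| / w 0 j.
Proof.
have a0 : 0 <= `|x - x'| / w 0 j by rewrite divr_ge0// ltW.
have := @coordinate_contract i
  (response_config x (response x)) (response_config x' (response x')) _
  (residual (response x) - residual (response x')) a0.
rewrite !response_config_self => H; apply: le_trans (H _ _ _) _.
- exact: residual_monotone.
- have := response_stationary x; have := response_stationary x'; lra.
- by move=> u; exact: response_config_lipschitz.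
(* The factor [lambda] is given up, as [regular] asks only for the constant 1. *)
- by rewrite ler_piMl// ltW.
Qed.

Lemma continuous_response : continuous response.
Proof.
move=> x; apply/cvgrPdist_le => eps eps0; near=> y.
have := response_lipschitz x y; rewrite ler_pdivrMr// => /le_trans; apply.
rewrite mulrAC ler_pdivrMr// -ler_pdivlMr//.
near: y; apply: (@cvgrPdist_le _ _ _ _ _ id x).1 => //.
by rewrite divr_gt0// mulr_gt0.
Unshelve. all: by end_near.
Qed.

(** Regularity propagates through an update, and the remainder disappears because [envelope] gives
    the derivative exactly. *)
Lemma regular_update c :
  regular i j (fun x => minval (update_objective x) + c) response (fun=> 0).
Proof.
have [_ [_ d2 _ [c2 _]]] := feC2 eij.
have D (x : R) : is_derive x 1 (fun x => minval (update_objective x) + c)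
    (partial2of2 (fe i j) (response x) x : R).
  pose S y := fv i y + \sum_(u | e i u && (u != j)) J u y.
  have E x' y : update_objective x' y = S y + fe i j y x'.
    by rewrite /update_objective /S addrAC.
  have -> : (fun x => minval (update_objective x) + c) =
      (fun x => S (response x) + fe i j (response x) x) + cst c.
    by apply/funext => x'; rewrite /minval E.
  rewrite -[X in is_derive _ _ _ X]addr0; apply: is_deriveD.
  apply: (envelope x d2 c2 continuous_response) => x' z.
  by rewrite -!E response_min.
have D' x : derive1 (fun x => minval (update_objective x) + c) x =
    partial2of2 (fe i j) (response x) x.
  by rewrite derive1E (is_derive_val (D x)).
split => //.
- move=> x; rewrite (funext D').
  by apply: (cvg_uncurry c2); [exact: continuous_response|exact: cvg_id].
- by move=> x; rewrite D' addr0.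
- exact: response_lipschitz.
Qed.

End Update.

(** * Existence and stationarity of the minimizer *)

Lemma continuous_objective : continuous F.
Proof.
have coord i (x : 'rV[R]_n.+1) : y 0 i @[y --> x] --> x 0 i.
  exact: (@coord_continuous R 1 n.+1 0 i).
have c1 : continuous (fun x : 'rV[R]_n.+1 => \sum_i fv i (x 0 i)).
  refine (@continuous_sum R 'rV[R]_n.+1 V xpredT
    (fun i x => fv i (x 0 i)) _) => i _ x.
  have [_ _ /(_ i)[_ _ [d1 _ _]] _ _] := hprog.
  have cf : continuous (fv i).
    by move=> s; exact/differentiable_continuous/derivable1_diffP/d1.
  exact: (cvg_comp _ (fv i) (coord i x) (cf _)).
have c2 : continuous (fun x : 'rV[R]_n.+1 =>
    \sum_i \sum_(j | e i j && (i < j)%N) fe i j (x 0 i) (x 0 j)).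
  refine (@continuous_sum R 'rV[R]_n.+1 V xpredT (fun i x =>
    \sum_(j | e i j && (i < j)%N) fe i j (x 0 i) (x 0 j)) _) => i _.
  refine (@continuous_sum R 'rV[R]_n.+1 V (fun j => e i j && (i < j)%N)
    (fun j x => fe i j (x 0 i) (x 0 j)) _) => j /andP[eij _] x.
  exact: (cvg_uncurry (feC2 eij).1 (coord i x) (coord j x)).
by move=> x; exact: cvgD (c1 x) (c2 x).
Qed.

Definition box (r : R) : set 'rV[R]_n.+1 :=
  [set x | forall i, `|x 0 i| <= r * w 0 i].

Lemma box_min r : 0 <= r ->
  exists x, box r x /\ forall z, box r z -> F x <= F z.
Proof.
move=> r0.
have cbox : compact (box r).
  rewrite (_ : box r = [set v : 'rV[R]_n.+1 | forall i,
      `[- (r * w 0 i), r * w 0 i]%classic (v ord0 i)]).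
    apply: (@rV_compact R n.+1
      (fun i => `[- (r * w 0 i), r * w 0 i]%classic)) => i.
    exact: segment_compact.
  by apply/seteqP; split => x xr i; have := xr i; rewrite /= in_itv/= ler_norml.
have box0 : box r !=set0.
  by exists 0 => i; rewrite mxE normr0 mulr_ge0// ltW.
have cF : {within box r, continuous F}.
  exact: continuous_subspaceT continuous_objective.
have [x xr minx] := EVT_min_rV box0 cbox cF.
by exists x; split => [|z zr]; [exact: set_mem|apply: minx; exact: mem_set].
Qed.

(** A common upper bound for the thresholds beyond which the growth of d_i F outweighs its value at
    0. *)
Definition box_radius : R := \sum_i `|G i 0| / ((1 - lambda) * M * w 0 i).

(** Comparison with the origin: since coordinate [i] is maximal, d_i F differs from [h * x 0 i] by
    at most [lambda * h * |x 0 i| + |G i 0|], which is too small to change the sign. *)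
Lemma outward_gradient (x : 'rV[R]_n.+1) i :
  (forall u, `|x 0 u| / w 0 u <= `|x 0 i| / w 0 i) ->
  box_radius < `|x 0 i| / w 0 i -> 0 < x 0 i * G i x.
Proof.
move=> maxi; rewrite ltr_pdivlMr// => xi.
have m0 : 0 <= `|x 0 i| / w 0 i by rewrite divr_ge0// ltW.
have [|h [Mh]] := @gradient_secant i x 0 _ m0.
  by move=> u _; rewrite mxE subr0 -ler_pdivrMr.
rewrite mxE subr0 -(mulrA lambda) mulfVK ?gt_eqF// => Gh.
have : `|G i 0| < (1 - lambda) * h * `|x 0 i|.
  apply: (@lt_le_trans _ _ ((1 - lambda) * M * `|x 0 i|)); last first.
    by rewrite ler_wpM2r// ler_wpM2l// ltW.
  rewrite mulrC -ltr_pdivrMr ?mulr_gt0//.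
  apply: le_lt_trans xi; rewrite -ler_pdivrMr// -mulrA -invfM.
  rewrite /box_radius (bigD1 i)//= lerDl; apply: sumr_ge0 => u _.
  by rewrite divr_ge0// !mulr_ge0// ltW.
have [x0|x0|->] := ltgtP (x 0 i) 0;
  last by rewrite normr0 mulr0 ltNge normr_ge0.
- move: Gh; rewrite (ltr0_norm x0) (nmulr_rgt0 _ x0) ler_norml => /andP[_ Gh].
  by have := ler_norm (G i 0); nra.
- move: Gh; rewrite (gtr0_norm x0) (pmulr_rgt0 _ x0) ler_norml => /andP[Gh _].
  by have := ler_norm (- G i 0); rewrite normrN; nra.
Qed.

Lemma inward_decrease (x v : 'rV[R]_n.+1) : \sum_i G i x * v 0 i < 0 ->
  exists s : R, 0 < s < 1 /\ F (x + s *: v) < F x.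
Proof.
set l := (X in X < 0) => l0.
have /is_derive_cvg := is_derive_objective hprog x v; rewrite -/l.
have l2 : 0 < - l / 2 by rewrite divr_gt0// oppr_gt0.
move=> /cvgrPdist_lt/(_ _ l2)/nbhs_ballP[d/= d0 H].
pose s := Num.min d 1 / 2.
have m0 : 0 < Num.min d 1 by rewrite lt_min d0 ltr01.
have s0 : 0 < s by rewrite divr_gt0.
have sd : s < d.
  have : Num.min d 1 <= d by rewrite ge_min lexx.
  by rewrite /s; lra.
have s1 : s < 1.
  have : Num.min d 1 <= 1 by rewrite ge_min lexx orbT.
  by rewrite /s; lra.
exists s; rewrite s0 s1; split => //.
have := H s; rewrite /ball/= sub0r normrN (gtr0_norm s0) => /(_ sd).
move=> /(_ (lt0r_neq0 s0)); rewrite (addrC (s *: v)).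
set D := F (x + s *: v) - F x; rewrite [s^-1 *: D]mulrC ltr_norml.
move=> /andP[lD _]; rewrite -subr_lt0 -/D.
have : D / s < 0 by lra.
by rewrite pmulr_llt0// invr_gt0.
Qed.

(* At a minimizer on a box, a coordinate of maximal weighted size larger than
   [box_radius] could be moved inwards, so the radius of the box is
   irrelevant. *)
Lemma box_min_bounded r x : box_radius <= r -> box r x ->
  (forall z, box r z -> F x <= F z) -> box box_radius x.
Proof.
move=> rr xr minx.
pose i := [arg max_(i > ord0) (`|x 0 i| / w 0 i)]%O.
have maxi u : `|x 0 u| / w 0 u <= `|x 0 i| / w 0 i.
  by rewrite /i; case: arg_maxP => // k _; exact.
have [xi u|xi] := leP (`|x 0 i| / w 0 i) box_radius.
  by rewrite -ler_pdivrMr//; exact: le_trans xi.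
have Gi := outward_gradient maxi xi.
pose v : 'rV[R]_n.+1 := - x 0 i *: delta_mx 0 i.
have vE u : v 0 u = if u == i then - x 0 i else 0.
  by rewrite !mxE eqxx/=; case: eqP; rewrite ?mulr1 ?mulr0.
have [|s [/andP[s0 s1] Fs]] := @inward_decrease x v.
  rewrite (bigD1 i)//= big1 ?addr0; last first.
    by move=> u ui; rewrite vE (negbTE ui) mulr0.
  by rewrite vE eqxx mulrN mulrC oppr_lt0.
suff /minx : box r (x + s *: v) by rewrite leNgt Fs.
move=> u; apply: le_trans (xr u).
rewrite mxE [X in _ + X]mxE vE.
case: eqP => [->|_]; last by rewrite mulr0 addr0.
rewrite mulrN -{1}[x 0 i]mul1r -mulrBl normrM ler_piMl//.
by rewrite ler_norml; apply/andP; split; lra.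
Qed.

(** Any [z] lies in some larger box, whose minimizer already lies in the box of radius [box_radius];
    so the minimizer on that fixed box is global. *)
Lemma minimizer_le z : F (minimizer e fv fe) <= F z.
Proof.
have R0 : 0 <= box_radius.
  by apply: sumr_ge0 => i _; rewrite divr_ge0// !mulr_ge0// ?ltW.
have [x [xr minx]] := box_min R0.
apply: (@argmin_le R _ F x) => {}z.
pose r := box_radius + \sum_i `|z 0 i| / w 0 i.
have zw u : 0 <= `|z 0 u| / w 0 u by rewrite divr_ge0// ltW.
have rr : box_radius <= r by rewrite lerDl sumr_ge0.
have [y [yr miny]] := box_min (le_trans R0 rr).
apply: (@le_trans _ _ (F y)); first exact/minx/(box_min_bounded rr).
apply: miny => u; rewrite -ler_pdivrMr// /r (bigD1 u)//= addrCA lerDl.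
by rewrite addr_ge0// sumr_ge0.
Qed.

Lemma gradient_minimizer i : G i (minimizer e fv fe) = 0.
Proof.
set x := minimizer e fv fe; pose v : 'rV[R]_n.+1 := delta_mx 0 i.
have D s := is_derive_line (is_derive_objective hprog (x + s *: v) v).
have : derive1 (fun s : R => F (x + s *: v)) 0 = 0.
  apply: stationary => [s|s]; first by have [] := D s.
  by rewrite scale0r addr0 minimizer_le.
rewrite derive1E (is_derive_val (D 0)) scale0r addr0.
by rewrite (sum_delta (G^~ x) predT).
Qed.

(** * Regularity of all messages and the error recursion *)

Variables (kappa : nat -> V -> V -> R) (J0 : V -> V -> R -> R).
Hypothesis hinit : admissible_init e fe J0.
Local Notation xs := (minimizer e fv fe).
Local Notation msg := (message e fv fe kappa J0).
Local Notation resp t i j := (response i j (fun u => msg t u i)).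

Let Gxs i : G i xs = 0. Proof. exact: gradient_minimizer i. Qed.

(** The response is the constant [z] of the initialization assumption, whose inequality says exactly
    that the remainder has nonnegative derivative. *)
Lemma regular_init u i : e u i ->
  exists Y r, regular u i (J0 u i) Y r.
Proof.
move=> eui; have [[d1 d2 c2] [z Hz]] := hinit eui.
have [_ _ _ /(_ _ _ eui)[_ [_ [_ _ _ [_ [_ dd _ _]]]]] _] := hprog.
pose f := partial2of2 (fe u i) z.
pose r y := derive1 (J0 u i) y - f y.
have dr y : derivable r y 1 by exact: (derivableB (d2 y) (dd z y)).
exists (fun=> z), r; split; first exact: d1.
- by move=> y; exact/differentiable_continuous/derivable1_diffP/d2.
- by move=> y; rewrite /r addrC subrK.
- move=> x y xy; rewrite -subr_ge0.
  have [c [_ ->]] := mean_value x y dr.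
  apply: mulr_ge0; last by rewrite subr_ge0.
  rewrite derive1E (deriveB (d2 c) (dd z c)) -!derive1E subr_ge0.
  exact: Hz.
- by move=> x y; rewrite subrr normr0 mul0r divr_ge0// ltW.
Qed.

Lemma regular_choice u (J : V -> R -> R) :
  (forall v, e u v -> exists Y r, regular v u (J v) Y r) ->
  exists Y r, forall v, e u v -> regular v u (J v) (Y v) (r v).
Proof.
move=> H.
pose P v (p : (R -> R) * (R -> R)) := e u v -> regular v u (J v) p.1 p.2.
have [v|f Hf] := @boolp.choice _ _ P.
  case: (pselect (e u v)) => [/H[Y [r Yr]]|neuv]; first by exists (Y, r).
  by exists (fun=> 0, fun=> 0).
by exists (fun v => (f v).1), (fun v => (f v).2).
Qed.

Lemma regular_message t u i : e u i ->
  exists Y r, regular u i (msg t u i) Y r.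
Proof.
elim: t u i => [|t IH] u i eui; first exact: regular_init.
have [|Y [r Hr]] := @regular_choice u (fun v => msg t v u).
  by move=> v; rewrite esym => /IH.
exists (resp t u i), (fun=> 0).
exact: (regular_update eui (fun v euv _ => Hr v euv)).
Qed.

Lemma regular_messages t u :
  exists Y r, forall v, e u v -> regular v u (msg t v u) (Y v) (r v).
Proof.
apply: (@regular_choice u (fun v => msg t v u)) => v.
by rewrite esym => /(regular_message t).
Qed.

Lemma regular_message_succ t u i : e u i ->
  regular u i (msg t.+1 u i) (resp t u i) (fun=> 0).
Proof.
move=> eui; have [Y [r Hr]] := regular_messages t u.
exact: (regular_update eui (fun v euv _ => Hr v euv)).
Qed.

Definition init_error : R := \sum_u \sum_(v | e u v)
  `|derive1 (J0 u v) (xs 0 v) - partial2of2 (fe u v) (xs 0 u) (xs 0 v)|.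

(** The constant that [coordinate_perturb] yields for the defect [init_error], with the smallest
    weight in place of [w 0 i]. *)
Definition response_radius : R := init_error / (M * minV (w 0)) / (1 - lambda).

Let minw0 : 0 < minV (w 0).
Proof. by apply: lt_bigmin => // i _. Qed.

Let minw i : minV (w 0) <= w 0 i.
Proof. exact: (bigmin_le_cond _ (w 0)). Qed.

Let maxw i : w 0 i <= maxV (w 0).
Proof. exact: (le_bigmax_cond _ (w 0)). Qed.

Let init_error0 : 0 <= init_error.
Proof. by apply: sumr_ge0 => u _; apply: sumr_ge0. Qed.

Let response_radius0 : 0 <= response_radius.
Proof. by rewrite !divr_ge0// ?ltW// mulr_gt0. Qed.

(** [C t] belongs to the responses computed from the messages at time [t], which are the responses
    of the messages at time [t.+1]. *)
Let C t := lambda ^+ t * response_radius.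

Let C0 t : 0 <= C t. Proof. by rewrite mulr_ge0// exprn_ge0// ltW. Qed.

Lemma init_error_bound (i j : V) : \sum_(u | e i u && (u != j))
    `|derive1 (J0 u i) (xs 0 i) - partial2of2 (fe u i) (xs 0 u) (xs 0 i)| <=
  init_error.
Proof.
rewrite big_mkcond/=; apply: ler_sum => u _.
case: ifP => [/andP[eiu _]|_]; last by apply: sumr_ge0.
have eui : e u i by rewrite esym.
by rewrite (bigD1 i eui) lerDl; apply: sumr_ge0.
Qed.

(** The configuration agrees with [xs] at [i] and [j]. Subtracting the equation d_i F = 0 at [xs]
    therefore leaves only the mismatch of the initial messages from the other neighbors. *)
Lemma gradient_init i j Y r : e i j ->
  (forall v, e i v -> regular v i (J0 v i) (Y v) (r v)) ->
  G i (response_config i j Y (xs 0 j) (xs 0 i)) + residual i j r (xs 0 i) =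
  \sum_(u | e i u && (u != j))
    (derive1 (J0 u i) (xs 0 i) - partial2of2 (fe u i) (xs 0 u) (xs 0 i)).
Proof.
move=> eij Hr.
have -> : G i (response_config i j Y (xs 0 j) (xs 0 i)) =
    derive1 (fv i) (xs 0 i) + (partial2of2 (fe j i) (xs 0 j) (xs 0 i) +
    \sum_(u | e i u && (u != j)) partial2of2 (fe u i) (Y u (xs 0 i)) (xs 0 i)).
  rewrite /gradient response_config_self (bigD1 j eij)/=.
  rewrite response_config_at//; congr (_ + (_ + _)).
  by apply: eq_bigr => u /andP[eiu uj]; rewrite response_config_nbr.
have -> : residual i j r (xs 0 i) =
    \sum_(u | e i u && (u != j)) r u (xs 0 i).
  rewrite /residual (bigD1 j eij)/= /clamp eqxx add0r.
  by apply: eq_bigr => u /andP[_ /negbTE ->].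
have := Gxs i; rewrite /gradient (bigD1 j eij)/= => Gi.
rewrite sumrB [in RHS](eq_bigr (fun u => partial2of2 (fe u i) (Y u (xs 0 i))
  (xs 0 i) + r u (xs 0 i))); last first.
  by move=> u /andP[eiu _]; have [_ _ -> _ _] := Hr u eiu.
by rewrite big_split/=; lra.
Qed.

(** The reference point keeps [i] and [j] at [xs] but lets the other neighbors follow [Y], so that
    the Lipschitz bounds apply. By [gradient_init] it misses stationarity by at most
    [init_error]. *)
Lemma response_error0 i j x : e i j ->
  `|resp 0 i j x - xs 0 i| / w 0 i <=
    Num.max (`|x - xs 0 j| / w 0 j) response_radius.
Proof.
move=> eij; have [Y [r Hr]] := regular_messages 0 i.
have regJ u (eiu : e i u) (_ : u != j) := Hr u eiu.
have a0 : 0 <= `|x - xs 0 j| / w 0 j by rewrite divr_ge0// ltW.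
set y := resp 0 i j x.
have := @coordinate_perturb i
  (response_config i j Y x y) (response_config i j Y (xs 0 j) (xs 0 i))
  _ (residual i j r y - residual i j r (xs 0 i)) init_error a0.
rewrite !response_config_self => H; apply: le_trans (H _ _ _) _.
- exact: (residual_monotone regJ).
- have S := response_stationary eij regJ x.
  rewrite (_ : _ + _ = - (G i (response_config i j Y (xs 0 j) (xs 0 i)) +
      residual i j r (xs 0 i))); last by rewrite -/y in S; lra.
  rewrite normrN gradient_init//.
  exact: le_trans (ler_norm_sum _ _ _) (init_error_bound i j).
- by move=> u eiu; exact: (response_config_lipschitz eij regJ).
- have Hi : init_error / (M * w 0 i) / (1 - lambda) <= response_radius.
    rewrite /response_radius ler_pM2r ?invr_gt0//.
    rewrite ler_wpM2l// lef_pV2 ?posrE ?mulr_gt0//.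
    by rewrite ler_pM2l.
  by rewrite ge_max !le_max lexx Hi orbT.
Qed.

(** After time 0 there is no remainder, and the comparison is with [xs] itself. The induction
    hypothesis, used at the solution [y], bounds each neighbor by the difference at [i] or by [C t];
    [coordinate_contract] removes the former. *)
Lemma response_error t i j x : e i j ->
  `|resp t i j x - xs 0 i| / w 0 i <= Num.max (`|x - xs 0 j| / w 0 j) (C t).
Proof.
elim: t i j x => [|t IH] i j x eij.
  by rewrite /C expr0 mul1r; exact: response_error0.
have regJ u (eiu : e i u) (_ : u != j) :=
  @regular_message_succ t u i (etrans (esym u i) eiu).
set y := resp t.+1 i j x; pose Y u := resp t u i.
have a0 : 0 <= Num.max (`|x - xs 0 j| / w 0 j) (C t) by rewrite le_max C0 orbT.
have := @coordinate_contract i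
  (response_config i j Y x y) xs _ 0 a0.
rewrite response_config_self => H; apply: le_trans (H _ _ _) _.
- by rewrite mul0r.
- rewrite Gxs subr0 addr0.
  have := response_stationary eij regJ x.
  rewrite [X in _ + X]big1 ?addr0// => u _.
  by rewrite /clamp; case: ifP.
- move=> u eiu; rewrite -ler_pdivrMr//.
  have [->|uj] := eqVneq u j.
    by rewrite response_config_at// !le_max lexx.
  rewrite response_config_nbr//.
  have := IH u i y; rewrite esym => /(_ eiu); rewrite !le_max.
  by case/orP => ->; rewrite ?orbT.
(* [lambda] is kept on [C t], which becomes [C t.+1], and given up on the other entry of the
   maximum. *)
- rewrite maxr_pMr ?(ltW lambda0)// /C exprS -mulrA.
  have la : lambda * (`|x - xs 0 j| / w 0 j) <= `|x - xs 0 j| / w 0 j.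
    by rewrite ler_piMl ?divr_ge0// ltW.
  by rewrite ge_max !le_max lexx la orbT.
Qed.

(** The same comparison with no neighbor held fixed: [C t] alone bounds the neighbors, and the local
    problem contributes one more factor [lambda]. *)
Lemma estimate_error t i :
  `|estimate e fv fe kappa J0 t.+1 0 i - xs 0 i| <=
    maxV (w 0) * (lambda ^+ t.+1 * response_radius).
Proof.
rewrite /estimate mxE /local_objective; set y := argmin _.
have regJ u (eiu : e i u) :=
  @regular_message_succ t u i (etrans (esym u i) eiu).
have [_ S] := local_argmin regJ; rewrite -/y in S.
pose Y u := resp t u i.
have := @coordinate_contract i
  (configuration i y Y) xs (C t) 0 (C0 t).
rewrite configuration_self mul0r Gxs subr0 addr0 => /(_ (lexx 0)) H.
have : `|y - xs 0 i| / w 0 i <= lambda * C t.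
  apply: H => [|u eiu]; first by move: S; rewrite big1 ?addr0.
  rewrite configuration_nbr// -ler_pdivrMr//.
  by have := @response_error t u i y; rewrite esym maxC; exact.
rewrite ler_pdivrMr// => /le_trans; apply.
rewrite mulrC /C mulrA -exprS; apply: ler_wpM2r => //.
by rewrite mulr_ge0// exprn_ge0// ltW.
Qed.

End MinSumConvergence.

Theorem theorem1 (R : realType) (n : nat) (e : rel 'I_n.+1)
    (fv : 'I_n.+1 -> R -> R) (fe : 'I_n.+1 -> 'I_n.+1 -> R -> R -> R)
    (lambda : R) (w : 'rV[R]_n.+1)
    (kappa : nat -> 'I_n.+1 -> 'I_n.+1 -> R)
    (J0 : 'I_n.+1 -> 'I_n.+1 -> R -> R)
    (hprog : pairwise_separable_convex e fv fe)
    (hsdd : scaled_diag_dominant lambda w (objective e fv fe))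
    (hinit : admissible_init e fe J0) :
  let x := estimate e fv fe kappa J0 in
  let xstar := minimizer e fv fe in
  let K := (curvature e fv fe)^-1 * (maxV (w 0) / minV (w 0)) in
  (forall t : nat, (0 < t)%N ->
    `|x t - xstar| <=
      K * (lambda ^+ t / (1 - lambda)) *
      \sum_u \sum_(v | e u v)
        `|derive1 (J0 u v) (xstar 0 v)
          - partial2of2 (fe u v) (xstar 0 u) (xstar 0 v)|) /\
  x t @[t --> \oo] --> xstar.
Proof.
move=> x xstar K.
have lambda0 : 0 < lambda by case: hsdd => /andP[].
have lambda1 : lambda < 1 by case: hsdd => /andP[].
have bound t : (0 < t)%N -> `|x t - xstar| <= K * (lambda ^+ t / (1 - lambda)) *
    init_error e fv fe J0.
  case: t => // t _.
  have -> : K * (lambda ^+ t.+1 / (1 - lambda)) * init_error e fv fe J0 =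
      maxV (w 0) * (lambda ^+ t.+1 * response_radius e fv fe lambda w J0).
    by rewrite /K /response_radius invfM; ring.
  have est := estimate_error hprog hsdd kappa hinit t.
  (* The norm of a row vector is its largest absolute entry. The bound is seen to be nonnegative
     from its validity at one coordinate. *)
  rewrite /Num.norm/= mx_normrE; apply: bigmax_le => [|[i j] _ /=].
    exact: le_trans (est ord0).
  by rewrite ord1 !mxE; have := est j; rewrite !mxE.
split; first exact: bound.
apply/cvgrPdist_le => eps eps0.
have geom : K * (lambda ^+ t / (1 - lambda)) * init_error e fv fe J0
    @[t --> \oo] --> 0.
  rewrite -[X in _ --> X](mul0r (init_error e fv fe J0)).
  apply: cvgMl; rewrite -[X in _ --> X](mulr0 K); apply: cvgMr.
  rewrite -[X in _ --> X](mul0r (1 - lambda)^-1); apply: cvgMl.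
  by apply: cvg_expr; rewrite gtr0_norm.
move/cvgrPdist_le : geom => /(_ _ eps0) geom; near=> t.
rewrite distrC; apply: le_trans (bound t _) _.
  by near: t; exact: nbhs_infty_gt.
by apply: le_trans (ler_norm _) _; rewrite -normrN -sub0r; near: t.
Unshelve. all: by end_near.
Qed.
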